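(* There exist numerical constants $C,c_1,c_2>0$ and $n_0\geq 1$ such that the following holds. Whenever $\rho\geq c_1\sqrt{\frac{\log n}{np}}$, $p\leq C\rho^{-1}$ and $n\geq n_0$, the maximum likelihood estimator $\widehat\pi$ satisfies $$\mathbb{P}\left[\mathrm{err}(\widehat{\pi},\pi^{\star})\neq 0\right]\leq \exp\left(-c_2\,np\rho^2\right).$$
   Context: Setting (multiple Gaussian graph alignment). Let $n\ge 2$, $p\geq 2$ be integers, $[n]=\{1,\dots,n\}$, $E=\binom{[n]}{2}$ the set of unordered pairs of distinct elements of $[n]$, and $\mathcal S_n$ the group of permutations of $[n]$. For $\pi=(\pi_1,\dots,\pi_p)\in(\mathcal S_n)^p$ and $e=\{u,v\}\in E$ write $\Pi_j(e)=\{\pi_j(u),\pi_j(v)\}$. Let $\rho\in[0,1]$. Let $\pi^\star=(\pi_1^\star,\dots,\pi^\star_p)$ be uniform on $(\mathcal S_n)^p$, and let $(H_{0e})_{e\in E}$, $(Z_{je})_{j\in[p],e\in E}$ be i.i.d. $\mathcal N(0,1)$ variables independent of $\pi^\star$. One observes $G=(G_{je})_{j\in[p],e\in E}$, $$G_{je}=\sqrt{\rho}\,H_{0\,\Pi^\star_j(e)}+\sqrt{1-\rho}\,Z_{je}.$$ $\mathbb P$ denotes the joint law of $(\pi^\star,G)$. The error is $$\mathrm{err}(\pi,\pi^\star)=\min_{\psi\in\mathcal S_n}\frac1{np}\sum_{u=1}^n\sum_{j=1}^p\mathbf 1\{\psi(\pi_j(u))\neq\pi_j^\star(u)\}.$$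 Maximum likelihood estimator (MLE): $\widehat\pi=\widehat\pi(G)$ is any element of $$\arg\max_{\pi\in(\mathcal S_n)^p}\ \sum_{j,j'\in[p]}\ \sum_{e,e'\in E}\mathbf 1\{\Pi_j(e)=\Pi_{j'}(e')\}\,G_{je}G_{j'e'}.$$ ''Numerical constant'' means a constant not depending on $n,p,\rho$. *)

(* Defs.v *)
From HB Require Import structures.
From mathcomp Require Import all_boot all_order all_algebra all_fingroup.
From mathcomp Require Import all_classical all_reals all_analysis.

Set Implicit Arguments.
Unset Strict Implicit.
Unset Printing Implicit Defensive.

Import Order.TTheory GRing.Theory Num.Theory.

Local Open Scope classical_set_scope.
Local Open Scope ring_scope.

Section Combinatorics.
Variable n : nat.

Definition edge := {e : {set 'I_n} | #|e| == 2%N}.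

Lemma card_edge_act (s : 'S_n) (e : edge) : #|s @: val e| == 2%N.
Proof. by rewrite card_imset ?(valP e) //; exact: perm_inj. Qed.

(* {u, v} |-> {s u, s v} *)
Definition edge_act (s : 'S_n) (e : edge) : edge :=
  Sub (s @: val e) (card_edge_act s e).

End Combinatorics.

Section Estimation.
Variables (R : realType) (n p : nat).

Definition perm_tuple := {ffun 'I_p -> 'S_n}.

Definition observation := 'I_p -> edge n -> R.

Definition misaligned (pi pistar : perm_tuple) (psi : 'S_n) : R :=
  (n * p)%:R^-1 *
  \sum_(u < n) \sum_(j < p) (psi (pi j u) != pistar j u)%:R.

(* The starting value of the iterated minimum is the value at psi = id, so
   this is the minimum of [misaligned pi pistar] over the whole of 'S_n. *)
Definition err (pi pistar : perm_tuple) : R :=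
  \big[Num.min/misaligned pi pistar 1%g]_(psi : 'S_n) misaligned pi pistar psi.

Definition alignment_score (g : observation) (pi : perm_tuple) : R :=
  \sum_(j < p) \sum_(j' < p) \sum_(e : edge n) \sum_(e' : edge n)
    (edge_act (pi j) e == edge_act (pi j') e')%:R * (g j e * g j' e').

Definition mle_set (g : observation) : set perm_tuple :=
  [set pi | forall pi' : perm_tuple,
     alignment_score g pi' <= alignment_score g pi].

End Estimation.

Section Independence.
Context d (T : measurableType d) (R : realType) (P : probability T R).

(* Mutual independence of a finite family of classes of events. *)
Definition mutually_independent (I : finType) (F : I -> set (set T)) : Prop :=
  forall (J : {set I}) (A : I -> set T), (forall i, i \in J -> F i (A i)) ->
    (P (\bigcap_(i in [set` J]) A i) = \prod_(i in J) P (A i))%E.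

(* sigma(X) for a real random variable X *)
Definition events_of_RV (X : {RV P >-> R}) : set (set T) :=
  preimage_set_system setT X measurable.

(* sigma(X) for X with values in a finite set, every subset of which is
   measurable *)
Definition events_of_discrete (S : finType) (X : T -> S) : set (set T) :=
  preimage_set_system setT X setT.

Definition standard_gaussian (X : {RV P >-> R}) : Prop :=
  forall A : set R, measurable A -> distribution P X A = normal_prob 0 1 A.

End Independence.

Section Model.
Context d (T : measurableType d) (R : realType) (P : probability T R).
Variables (n p : nat).
Variables (pistar : T -> perm_tuple n p).
Variables (H0 : edge n -> {RV P >-> R}) (Z : 'I_p -> edge n -> {RV P >-> R}).

(* The index set of the family (pistar, (H0 e)_e, (Z j e)_(j, e)): [None]
   stands for pistar, [inl e] for H0 e and [inr (j, e)] for Z j e. *)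
Definition model_events (i : option (edge n + 'I_p * edge n)) : set (set T) :=
  match i with
  | None => events_of_discrete pistar
  | Some (inl e) => events_of_RV (H0 e)
  | Some (inr je) => events_of_RV (Z je.1 je.2)
  end.

Record alignment_model : Prop := AlignmentModel {
  pistar_measurable : forall pi, measurable (pistar @^-1` [set pi]);
  pistar_uniform : forall pi,
    P (pistar @^-1` [set pi]) = (#|{: perm_tuple n p}|%:R^-1)%:E;
  H0_gaussian : forall e, standard_gaussian (H0 e);
  Z_gaussian : forall j e, standard_gaussian (Z j e);
  model_independent : mutually_independent P model_events }.

Definition observed (rho : R) (w : T) : observation R n p :=
  fun j e => Num.sqrt rho * H0 (edge_act (pistar w j) e) w
             + Num.sqrt (1 - rho) * Z j e w.

End Model.

(* Main.v *)
Require Import Defs.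
From HB Require Import structures.
From mathcomp Require Import all_boot all_order all_algebra all_fingroup.
From mathcomp Require Import all_classical all_reals all_analysis.
From mathcomp Require Import measurable_realfun zify ring lra.

(* Condition on pistar = s.  The difference between the scores of a competitor t
   and of s is a quadratic form in the standard Gaussian variables H0, Z, with
   mean - rho K and squared Frobenius norm of order K, where K counts the pairs
   of observed edges that have the same image under s but not under t.  Since
   p rho <= 1, Chernoff's bound with parameter rho / 48 shows that t beats s with
   probability at most exp (- rho^2 K / 96).  The exponential moment comes from
   integrating the variables one at a time: the matrix changes by a Schur
   complement, which preserves the operator norm bound and does not increase
   trace + 3 (Frobenius norm)^2.
   Relabelling an estimator does not change its score, so the competitor may be
   taken to have the fewest mismatches d with s among its relabellings; averaging
   over the p relabellings that match one coordinate of s gives K >= p d n / 4.  The sum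
   of q^d over all competitors is at most (1 + n q)^(n p) - 1, and it is small
   for q = exp (- n p rho^2 / 384) as soon as n p rho^2 >= 4096 ln n. *)

Set Implicit Arguments.
Unset Strict Implicit.
Unset Printing Implicit Defensive.

Import Order.TTheory GRing.Theory Num.Theory.

Local Open Scope classical_set_scope.
Local Open Scope ring_scope.

(** * Gaussian integration *)

Section GaussianIntegral.
Context {R : realType}.

(* Completing the square turns the integrand times the standard density into
   s expR (2 b^2 s^2) times the density of N(2 b s^2, s^2). *)
Lemma normal_pdf_tilt (b s x : R) : 0 < s ->
  expR ((1 - s ^- 2) / 2 * x ^+ 2 + 2 * b * x) * normal_pdf 0 1 x =
  s * expR (2 * b ^+ 2 * s ^+ 2) * normal_pdf (2 * b * s ^+ 2) s x.
Proof.
move=> s0; have sN0 : s != 0 by rewrite gt_eqF.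
have peakE : normal_peak s = s^-1 * normal_peak 1.
  rewrite /normal_peak -invfM; congr (_^-1).
  rewrite (_ : s ^+ 2 * pi *+ 2 = s ^+ 2 * (1 ^+ 2 * pi *+ 2)); last by ring.
  by rewrite (sqrtrM _ (sqr_ge0 s)) sqrtr_sqr gtr0_norm.
rewrite !normal_pdfE ?oner_neq0// peakE /normal_fun; set c := normal_peak 1.
rewrite [LHS]mulrCA -expRD.
rewrite [RHS](_ : _ = c * (expR (2 * b ^+ 2 * s ^+ 2) *
  expR (- (x - 2 * b * s ^+ 2) ^+ 2 / (s ^+ 2 *+ 2)))); last by field.
by rewrite -expRD; congr (_ * expR _); field.
Qed.

Local Open Scope ereal_scope.
Notation mu := (@lebesgue_measure R).

Import HBNNSimple.

(** By linearity only indicators of level sets matter, and for these the formula is the definition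
    of [normal_prob]. Monotone convergence then extends it to nonnegative measurable functions. *)
Lemma integral_normal_prob_nnsfun (m s : R) (f : {nnsfun _ >-> R}) :
  \int[normal_prob m s]_x (f x)%:E =
  \int[mu]_x ((f x)%:E * (normal_pdf m s x)%:E).
Proof.
have pdf_ge0 x : 0 <= (normal_pdf m s x)%:E by rewrite lee_fin normal_pdf_ge0.
have mpdf : measurable_fun setT (fun x : measurableTypeR R => (normal_pdf m s x)%:E).
  by apply: measurableT_comp => //; exact: measurable_normal_pdf.
have mfr r : measurable (f @^-1` [set r]).
  by rewrite -[X in measurable X]setTI; apply: (measurable_funPT f).
have mfi r : measurable_fun setT
    (fun x : measurableTypeR R => (r * \1_(f @^-1` [set r]) x)%:E).
  by apply/measurable_EFinP; apply: measurable_funM => //; exact: measurable_indic.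
under [LHS]eq_integral do rewrite fimfunE -fsumEFin//.
rewrite [LHS]ge0_integral_fsum//; last first.
  by move=> r x _; rewrite EFinM nnfun_muleindic_ge0.
under [RHS]eq_integral.
  move=> x xD; rewrite fimfunE -fsumEFin// muleC ge0_mule_fsumr; last first.
    by move=> r; rewrite EFinM nnfun_muleindic_ge0.
  over.
rewrite [RHS]ge0_integral_fsum//; last 2 first.
  - by move=> r; apply: emeasurable_funM.
  - by move=> r x _; rewrite EFinM mule_ge0// nnfun_muleindic_ge0.
apply: eq_fsbigr => r /[!inE] -[t _ frt].
have r0 : (0 <= r)%R by rewrite -frt.
under eq_integral do rewrite EFinM.
rewrite ge0_integralZl//; last exact/measurable_EFinP/measurable_indic.
rewrite integral_indic// setIT.
under [RHS]eq_integral do rewrite EFinM muleCA.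
rewrite ge0_integralZl//; last 2 first.
  - by apply: emeasurable_funM => //; exact/measurable_EFinP/measurable_indic.
  - by move=> x _; rewrite mule_ge0// lee_fin.
congr (_ * _).
rewrite /= /normal_prob [LHS]integral_mkcond; apply: eq_integral => x _.
by rewrite epatch_indic.
Qed.

Lemma integral_normal_prob (m s : R) (f : measurableTypeR R -> \bar R) :
  measurable_fun setT f -> (forall x, 0 <= f x) ->
  \int[normal_prob m s]_x f x = \int[mu]_x (f x * (normal_pdf m s x)%:E).
Proof.
move=> mf f0; pose f_ := nnsfun_approx measurableT mf.
have pdf_ge0 x : 0 <= (normal_pdf m s x)%:E by rewrite lee_fin normal_pdf_ge0.
have mpdf : measurable_fun setT (fun x : measurableTypeR R => (normal_pdf m s x)%:E).
  by apply: measurableT_comp => //; exact: measurable_normal_pdf.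
transitivity (lim (\int[normal_prob m s]_x (f_ n x)%:E @[n --> \oo])).
  rewrite -monotone_convergence//=.
  - apply: eq_integral => ? /[!inE] xD; apply/esym/cvg_lim => //=.
    exact: cvg_nnsfun_approx.
  - by move=> n; exact/measurable_EFinP/measurable_funTS.
  - by move=> n ? _; rewrite lee_fin.
  - by move=> ? _ ? ? mn; rewrite lee_fin; exact/lefP/nd_nnsfun_approx.
under eq_fun do rewrite integral_normal_prob_nnsfun.
rewrite -monotone_convergence//=.
- apply: eq_integral => x _.
  have cf : (f_ n x)%:E @[n --> \oo] --> f x by exact: cvg_nnsfun_approx.
  apply/cvg_lim => //.
  under eq_fun do rewrite muleC.
  by rewrite muleC; apply: cvgeZl.
- move=> n; apply: emeasurable_funM => //.
  exact/measurable_EFinP/measurable_funTS.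
- by move=> n x _; rewrite mule_ge0// lee_fin.
- move=> x _ m1 m2 mn; apply: lee_wpmul2r => //.
  by rewrite lee_fin; exact/lefP/nd_nnsfun_approx.
Qed.

(** The parameter [s] is the standard deviation of the tilted normal law, whose density integrates
    to 1. *)
Lemma integral_expR_quadratic_normal (b s : R) : (0 < s)%R ->
  \int[normal_prob 0 1]_x (expR ((1 - s ^- 2) / 2 * x ^+ 2 + 2 * b * x))%:E =
  (s * expR (2 * b ^+ 2 * s ^+ 2))%:E.
Proof.
move=> s0; have sN0 : s != 0%R by rewrite gt_eqF.
have mf : measurable_fun setT (fun x : measurableTypeR R =>
    (expR ((1 - s ^- 2) / 2 * x ^+ 2 + 2 * b * x))%:E).
  apply/measurable_EFinP; apply: measurableT_comp => //.
  by apply: measurable_funD; apply: measurable_funM => //; exact: measurable_funX.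
rewrite integral_normal_prob//.
under eq_integral do rewrite -EFinM normal_pdf_tilt// EFinM.
rewrite ge0_integralZl//.
- by rewrite integral_normal_pdf mule1.
- by apply/measurable_EFinP; exact: measurable_normal_pdf.
- by move=> x _; rewrite lee_fin normal_pdf_ge0.
- by rewrite lee_fin mulr_ge0 ?expR_ge0 ?ltW.
Qed.

End GaussianIntegral.

(** * Integrating out an independent normal variable *)

Section IndependentIntegration.
Context d (T : measurableType d) {R : realType} (P : probability T R).
Local Open Scope ereal_scope.

(** The formula on rectangles identifies the joint law as a product measure, and Tonelli applies.
    [Y] may be the identity into a coarser sigma-algebra. *)
Lemma ge0_integral_indep d1 d2 (T1 : measurableType d1) (T2 : measurableType d2)
    (Y : T -> T1) (X : T -> T2) (mu : probability T2 R) :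
  measurable_fun setT Y -> measurable_fun setT X ->
  (forall A B, measurable A -> measurable B ->
     P (Y @^-1` A `&` X @^-1` B) = P (Y @^-1` A) * mu B) ->
  forall F : T1 * T2 -> \bar R, measurable_fun setT F -> (forall z, 0 <= F z) ->
  \int[P]_w F (Y w, X w) = \int[P]_w \int[mu]_y F (Y w, y).
Proof.
move=> mY mX YX F mF F0.
pose Yr : {RV P >-> T1} := mfun_Sub (mem_set mY).
have mYX : measurable_fun setT (fun w => (Y w, X w)) by exact: measurable_fun_pair.
pose YXr : {RV P >-> (T1 * T2)%type} := mfun_Sub (mem_set mYX).
transitivity (\int[distribution P YXr]_z F z).
  by rewrite ge0_integral_distribution.
transitivity (\int[distribution P Yr \x mu]_z F z).
  apply: eq_measure_integral => A mA _; apply/esym.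
  by apply: product_measure_unique => // A1 A2 mA1 mA2; exact: YX.
rewrite fubini_tonelli1// ge0_integral_distribution//.
- exact: measurable_fun_fubini_tonelli_F.
- by move=> y; exact: integral_ge0.
Qed.

(** The family is i.i.d. standard normal and independent of [E]. Later [E] fixes the value of
    [pistar], and integrals over [E] replace conditioning. *)
Definition indep_normal (E : set T) (I : finType)
    (X : I -> T -> R) :=
  forall B : I -> set (measurableTypeR R), (forall i, measurable (B i)) ->
    P (\bigcap_i (X i @^-1` B i)) = \prod_i normal_prob 0 1 (B i) /\
    P (E `&` \bigcap_i (X i @^-1` B i)) = P E * \prod_i normal_prob 0 1 (B i).

Lemma indep_normal_enum (E : set T) (I : finType)
    (X : I -> T -> R) :
  indep_normal E X -> indep_normal E (fun k : 'I_#|I| => X (enum_val k)).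
Proof.
move=> iX B mB.
have BE : \bigcap_k (X (enum_val k) @^-1` B k) =
    \bigcap_i (X i @^-1` B (enum_rank i)).
  rewrite eqEsubset; split => w h i _ /=.
    by have := h (enum_rank i) Logic.I; rewrite /= enum_rankK.
  by have := h (enum_val i) Logic.I; rewrite /= enum_valK.
rewrite BE; have := iX (fun i => B (enum_rank i)) (fun i => mB (enum_rank i)).
suff -> : \prod_i normal_prob 0 1 (B (enum_rank i)) =
  \prod_k normal_prob 0 1 (B k) :> \bar R by [].
rewrite (reindex (@enum_val I predT)); last exact/onW_bij/enum_val_bij.
by apply: eq_bigr => k _; rewrite enum_valK.
Qed.

Lemma indep_normal_lift (E : set T) N (X : 'I_N.+1 -> T -> R) :
  indep_normal E X -> indep_normal E (fun i => X (lift ord0 i)).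
Proof.
move=> iX B mB.
pose B' (i : 'I_N.+1) := if unlift ord0 i is Some j then B j else setT.
have mB' i : measurable (B' i) by rewrite /B'; case: unliftP.
have B'E : \bigcap_i (X i @^-1` B' i) = \bigcap_i (X (lift ord0 i) @^-1` B i).
  rewrite eqEsubset; split => w h i _ /=.
    by have := h (lift ord0 i) Logic.I; rewrite /B' /= liftK.
  by rewrite /B'; case: unliftP => [j ->|//]; exact: h.
have := iX B' mB'; rewrite B'E big_ord_recl /B' unlift_none probability_setT mul1e.
by under eq_bigr do rewrite liftK.
Qed.

(** Measurability of [f] is asked over all measurable spaces because [f] is evaluated on a product
    whose first factor is [T] with a smaller sigma-algebra. *)
Lemma integral_indep_normal (E : set T) N (X : 'I_N.+1 -> T -> R)
    (f : R -> ('I_N -> R) -> R) :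
  measurable E -> (forall i, measurable_fun setT (X i)) -> indep_normal E X ->
  (forall d' (S : measurableType d') (y : S -> R)
     (x : 'I_N -> S -> R),
     measurable_fun setT y -> (forall i, measurable_fun setT (x i)) ->
     measurable_fun setT (fun s => f (y s) (fun i => x i s))) ->
  (forall y x, 0 <= f y x)%R ->
  \int[P]_(w in E) (f (X ord0 w) (fun i => X (lift ord0 i) w))%:E =
  \int[P]_(w in E) \int[normal_prob 0 1]_y (f y (fun i => X (lift ord0 i) w))%:E.
Proof.
move=> mE mX iX mf f0.
(* X ord0 is independent of the sigma-algebra generated by G, with respect to
   which E and the other variables are measurable. *)
pose G : set (set T) := [set A | exists b : bool,
  exists2 B : 'I_N -> set (measurableTypeR R), (forall i, measurable (B i)) &
  A = (if b then E else setT) `&` \bigcap_i (X (lift ord0 i) @^-1` B i)].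
pose S := g_sigma_algebraType G.
have GI : setI_closed G.
  move=> _ _ [b [B mB ->]] [b' [B' mB' ->]]; exists (b || b').
  exists (fun i => B i `&` B' i); first by move=> i; exact: measurableI.
  rewrite setIACA; congr (_ `&` _); last first.
    rewrite eqEsubset; split => w.
      by move=> [h h'] i _; split; [exact: h|exact: h'].
    by move=> h; split=> i _; have [] := h i Logic.I.
  by case: b; case: b'; rewrite /= ?setIT ?setTI ?setIid.
have GT : G setT.
  exists false, (fun=> setT) => //; rewrite setTI.
  by rewrite eqEsubset; split.
have GE : G E.
  exists true, (fun=> setT) => //; rewrite (_ : \bigcap_i _ = setT) ?setIT//.
  by rewrite eqEsubset; split.
have mG A : G A -> measurable A.
  move=> [b [B mB ->]]; apply: measurableI; first by case: b.
  apply: fin_bigcap_measurable => [|i _]; first exact: finite_finset.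
  by rewrite -[X in measurable X]setTI; exact: (mX _ measurableT _ (mB i)).
have mGs (A : set S) : measurable A -> measurable (A : set T).
  by move=> mA; apply: (smallest_sub _ mG mA); exact: sigma_algebra_measurable.
have mid : measurable_fun setT (id : T -> S).
  by move=> _ A mA; rewrite setTI; exact: mGs.
have mXS i : measurable_fun setT (X (lift ord0 i) : S -> measurableTypeR R).
  move=> _ A mA; rewrite setTI; apply: sub_sigma_algebra.
  exists false, (fun j => if j == i then A else setT).
    by move=> j; case: ifP.
  rewrite setTI eqEsubset; split => w /=.
    by move=> h j _ /=; case: eqP => [->|].
  by move=> /(_ i Logic.I) /=; rewrite eqxx.
have GP A B : G A -> measurable B ->
    P (A `&` X ord0 @^-1` B) = P A * normal_prob 0 1 B.
  move=> [b [C mC ->]] mB.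
  pose C' B (i : 'I_N.+1) := if unlift ord0 i is Some j then C j else B.
  have mC' B' : measurable B' -> forall i, measurable (C' B' i).
    by move=> mB' i; rewrite /C'; case: unliftP.
  have C'E B' : \bigcap_i (X i @^-1` C' B' i) =
      \bigcap_i (X (lift ord0 i) @^-1` C i) `&` X ord0 @^-1` B'.
    rewrite eqEsubset; split => w.
      move=> h; split => [i _|] /=.
        by have := h (lift ord0 i) Logic.I; rewrite /C' /= liftK.
      by have := h ord0 Logic.I; rewrite /C' /= unlift_none.
    by move=> [h h'] i _ /=; rewrite /C'; case: unliftP => [j ->|->//]; exact: h.
  have prodE B' : \prod_(i < N.+1) normal_prob 0 1 (C' B' i) =
      normal_prob 0 1 B' * \prod_(i < N) normal_prob 0 1 (C i) :> \bar R.
    rewrite big_ord_recl /C' unlift_none.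
    by under eq_bigr do rewrite liftK.
  have [h1 h2] := iX _ (mC' _ mB).
  (* Taking the whole line for [X ord0] gives the probability of the other events alone, so its
     factor splits off. *)
  have [h3 h4] := iX _ (mC' _ measurableT).
  rewrite !C'E !prodE in h1 h2 h3 h4.
  rewrite preimage_setT setIT probability_setT mul1e in h3 h4.
  rewrite -setIA; case: b => /=.
    by rewrite h2 h4 muleCA muleC.
  by rewrite !setTI h1 h3 muleC.
(* Both sides are finite measures in [A] that agree on the intersection-closed class [G], hence on
   the sigma-algebra it generates. *)
have SP (A : set S) B : measurable A -> measurable B ->
    P (A `&` X ord0 @^-1` B) = P A * normal_prob 0 1 B.
  move=> mA mB.
  have mXB : measurable (X ord0 @^-1` B).
    by rewrite -[X in measurable X]setTI; exact: (mX _ measurableT _ mB).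
  have k0 : (0 <= fine (normal_prob 0 1 B : \bar R))%R by exact/fine_ge0.
  pose m1 := pushforward (mrestr P mXB) (id : T -> S).
  pose m2 := pushforward (mscale (NngNum k0) P) (id : T -> S).
  have kE : (fine (normal_prob 0 1 B))%:E = normal_prob 0 1 B :> \bar R.
    by rewrite fineK// fin_num_measure.
  suff : m1 A = m2 A.
    rewrite /m1 /m2 /pushforward /mrestr /mscale /= ?preimage_id => ->.
    by rewrite kE muleC.
  apply: (@measure_unique _ R S G (fun=> setT)) => //.
  - by rewrite bigcup_const//; exists 0%N.
  - move=> C GC.
    change (P (C `&` X ord0 @^-1` B) = (fine (normal_prob 0 1 B))%:E * P C).
    by rewrite kE GP// muleC.
  - move=> _; change (P (setT `&` X ord0 @^-1` B) < +oo).
    by rewrite setTI; apply: (le_lt_trans (probability_le1 P mXB)); exact: ltry.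
have mES : measurable (E : set S) by exact: sub_sigma_algebra.
pose F (z : S * measurableTypeR R) : \bar R :=
  (\1_E z.1 * f z.2 (fun i => X (lift ord0 i) z.1))%:E.
have mF : measurable_fun setT F.
  apply/measurable_EFinP; apply: measurable_funM.
    have mI : measurable_fun setT (\1_E : S -> R) by exact: measurable_indic.
    exact: (measurableT_comp mI measurable_fst).
  refine (mf _ (S * measurableTypeR R)%type snd
    (fun i z => X (lift ord0 i) z.1) _ _) => [|i]; first exact: measurable_snd.
  exact: (measurableT_comp (mXS i) measurable_fst).
have F0 z : 0 <= F z by rewrite lee_fin mulr_ge0.
have := ge0_integral_indep (mu := normal_prob 0 1) mid (mX ord0) SP mF F0.
rewrite /F /= => FE.
rewrite [LHS]integral_mkcond [RHS]integral_mkcond.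
transitivity (\int[P]_w (\1_E w * f (X ord0 w) (fun i => X (lift ord0 i) w))%:E).
  apply: eq_integral => w _; rewrite patchE indicE.
  by case: ifP => wE; rewrite ?mul1r ?mul0r.
rewrite FE; apply: eq_integral => w _; rewrite patchE.
case: ifP => wE.
  by apply: eq_integral => y _; rewrite indicE wE mul1r.
by under eq_integral do rewrite indicE wE mul0r; rewrite integral0.
Qed.

End IndependentIntegration.

(** * Exponential moments of quadratic forms *)

Section QuadraticForms.
Context {R : realFieldType}.

Definition quad {I : finType} (A : I -> I -> R) (x : I -> R) : R :=
  \sum_i \sum_j A i j * (x i * x j).

Definition trace {I : finType} (A : I -> I -> R) : R := \sum_i A i i.

Definition frob {I : finType} (A : I -> I -> R) : R := \sum_i \sum_j A i j ^+ 2.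

(* Gaussian integration of the first variable of [expR (quad A x)] leaves the
   exponential of this form, up to a scalar. *)
Definition schur N (A : 'I_N.+1 -> 'I_N.+1 -> R) : 'I_N -> 'I_N -> R :=
  fun i j => A (lift ord0 i) (lift ord0 j) +
    2 / (1 - 2 * A ord0 ord0) * (A ord0 (lift ord0 i) * A ord0 (lift ord0 j)).

Definition cons_fun N (y : R) (x : 'I_N -> R) : 'I_N.+1 -> R :=
  fun i => if unlift ord0 i is Some j then x j else y.

Lemma cons_fun0 N y (x : 'I_N -> R) : cons_fun y x ord0 = y.
Proof. by rewrite /cons_fun unlift_none. Qed.

Lemma cons_funS N y (x : 'I_N -> R) i : cons_fun y x (lift ord0 i) = x i.
Proof. by rewrite /cons_fun liftK. Qed.

Lemma sqr_sum (I : finType) (x : I -> R) :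
  (\sum_i x i) ^+ 2 = \sum_i \sum_j x i * x j.
Proof.
by rewrite expr2 mulr_suml; apply: eq_bigr => i _; rewrite mulr_sumr.
Qed.

Section FirstVariable.
Variables (N : nat) (A : 'I_N.+1 -> 'I_N.+1 -> R).
Hypothesis symA : forall i j, A i j = A j i.

Let a := A ord0 ord0.
Let b i := A ord0 (lift ord0 i).
Let A0 i j := A (lift ord0 i) (lift ord0 j).
Let beta := \sum_i b i ^+ 2.

Lemma quad_recl x : quad A x = a * x ord0 ^+ 2 +
  2 * x ord0 * (\sum_i b i * x (lift ord0 i)) + quad A0 (fun i => x (lift ord0 i)).
Proof.
rewrite /quad big_ord_recl big_ord_recl -/a.
under [X in _ + X = _]eq_bigr do rewrite big_ord_recl symA -/(b _).
rewrite big_split /=.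
have -> : \sum_(i < N) b i * (x (lift ord0 i) * x ord0) =
    x ord0 * \sum_i b i * x (lift ord0 i).
  by rewrite mulr_sumr; apply: eq_bigr => i _; ring.
have -> : \sum_(i < N) A ord0 (lift ord0 i) * (x ord0 * x (lift ord0 i)) =
    x ord0 * \sum_i b i * x (lift ord0 i).
  by rewrite mulr_sumr; apply: eq_bigr => i _; rewrite /b; ring.
by rewrite /A0; ring.
Qed.

Lemma quad_schur x : quad (schur A) x =
  quad A0 x + 2 / (1 - 2 * a) * (\sum_i b i * x i) ^+ 2.
Proof.
rewrite sqr_sum mulr_sumr -big_split; apply: eq_bigr => i _ /=.
rewrite mulr_sumr -big_split; apply: eq_bigr => j _ /=.
by rewrite /schur -/a -/(b i) -/(b j) /A0; ring.
Qed.

Lemma trace_schur : trace (schur A) = trace A - a + 2 / (1 - 2 * a) * beta.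
Proof.
rewrite /trace big_ord_recl -/a mulr_sumr [a + _]addrC addrK -big_split.
by apply: eq_bigr => i _; rewrite /schur -/a -/(b i) expr2.
Qed.

Lemma frob_schur : frob (schur A) = frob A - a ^+ 2 - 2 * beta +
  2 * (2 / (1 - 2 * a)) * quad A0 b + (2 / (1 - 2 * a)) ^+ 2 * beta ^+ 2.
Proof.
have -> : frob A = a ^+ 2 + 2 * beta + frob A0.
  rewrite /frob big_ord_recl big_ord_recl -/a.
  under [X in _ + X = _]eq_bigr do rewrite big_ord_recl symA -/(b _).
  by rewrite big_split /= /beta /b /A0; ring.
set k := 2 / _.
have -> : frob (schur A) = frob A0 + 2 * k * quad A0 b + k ^+ 2 * beta ^+ 2.
  rewrite /frob /quad (sqr_sum (fun i => b i ^+ 2)) !mulr_sumr -!big_split.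
  apply: eq_bigr => i _ /=; rewrite !mulr_sumr -!big_split.
  apply: eq_bigr => j _ /=.
  by rewrite /schur -/a -/k -/(b i) -/(b j) /A0; ring.
by ring.
Qed.

Variable kappa : R.
Hypotheses (kappa_gt0 : 0 < kappa) (kappa_le : kappa <= 8^-1).
Hypothesis bndA : forall x, `|quad A x| <= kappa * \sum_i x i ^+ 2.

Let bnd_cons y x : `|a * y ^+ 2 + 2 * y * (\sum_i b i * x i) + quad A0 x| <=
  kappa * (y ^+ 2 + \sum_i x i ^+ 2).
Proof.
have consE : (fun i => cons_fun y x (lift ord0 i)) = x.
  by apply/funext => i; rewrite cons_funS.
have := bndA (cons_fun y x); rewrite quad_recl big_ord_recl cons_fun0 consE.
under eq_bigr do rewrite cons_funS.
by under [\sum_(i < N) cons_fun _ _ _ ^+ 2]eq_bigr do rewrite cons_funS.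
Qed.

Let bnd0 x : `|quad A0 x| <= kappa * \sum_i x i ^+ 2.
Proof. by have := bnd_cons 0 x; rewrite expr0n/= !mulr0 mul0r !add0r. Qed.

Lemma first_entry_bound : `|a| <= kappa.
Proof.
have := bnd_cons 1 (fun=> 0).
have -> : quad A0 (fun=> 0) = 0.
  by rewrite /quad big1// => i _; rewrite big1// => j _; rewrite !mulr0.
have -> : \sum_i b i * 0 = 0 by rewrite big1// => i _; rewrite mulr0.
have -> : \sum_(i < N) 0 ^+ 2 = 0 :> R by rewrite big1// => i _; rewrite expr0n.
by rewrite expr1n !mulr1 mulr0 !addr0 mulr1.
Qed.

(** Between the first entries [kappa] and [- kappa], followed by [b], the form changes by
    [4 kappa beta], while both values are at most [kappa (kappa^2 + beta)] in absolute value. *)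
Lemma first_row_bound : beta <= kappa ^+ 2.
Proof.
have bb : \sum_i b i * b i = beta by apply: eq_bigr => i _; rewrite expr2.
have := bnd_cons kappa b; have := bnd_cons (- kappa) b; rewrite !bb -/beta.
rewrite !ler_norml => /andP[h1 h2] /andP[h3 h4].
rewrite -(ler_pM2l kappa_gt0); lra.
Qed.

Lemma first_pivot_gt0 : 3 / 4 <= 1 - 2 * a.
Proof.
have := kappa_le; have := first_entry_bound; rewrite ler_norml => /andP[_].
by move: a => u h k; lra.
Qed.

(** The Schur form at [x] is the maximum over [y] of the form of [A] at [(y, x)] minus [y^2 / 2],
    attained at [y = 2 c / p]; the subtracted term absorbs [kappa y^2]. From below, it is the form
    of [A0] plus a nonnegative term. *)
Lemma schur_bound x : `|quad (schur A) x| <= kappa * \sum_i x i ^+ 2.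
Proof.
have piv := first_pivot_gt0.
rewrite quad_schur; set c := \sum_i _; set p := 1 - 2 * a.
pose y := 2 * c / p.
have p0 : 0 < p by rewrite /p; lra.
have pN0 : p != 0 by rewrite gt_eqF.
have yp : 2 / p * c ^+ 2 = p * y ^+ 2 / 2 by rewrite /y; field.
have := bnd_cons y x; have := bnd0 x; rewrite -/c !ler_norml.
move=> /andP[h1 h2] /andP[h3 h4].
have y2 : 0 <= y ^+ 2 by exact: sqr_ge0.
have py2 : 0 <= p * y ^+ 2 by rewrite mulr_ge0// ltW.
have ky2 : kappa * y ^+ 2 <= 8^-1 * y ^+ 2 by rewrite ler_wpM2r.
have yc : 2 * y * c = p * y ^+ 2 by rewrite /y; field.
rewrite yp; apply/andP; split; first by lra.
have : p * y ^+ 2 = y ^+ 2 - 2 * (a * y ^+ 2) by rewrite /p; ring.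
by lra.
Qed.

(* expR (a + 3 a^2) bounds the scalar (1 - 2 a)^(-1/2) produced by integrating
   the first variable. *)
Lemma trace_frob_schur :
  a + 3 * a ^+ 2 + (trace (schur A) + 3 * frob (schur A)) <=
  trace A + 3 * frob A.
Proof.
have piv := first_pivot_gt0.
rewrite trace_schur frob_schur; set k := 2 / _; set q := quad A0 b.
have p0 : 0 < 1 - 2 * a by lra.
have k0 : 0 <= k by rewrite /k divr_ge0// ltW.
have k83 : k <= 8 / 3 by rewrite /k ler_pdivrMr//; lra.
have beta0 : 0 <= beta by apply: sumr_ge0 => i _; exact: sqr_ge0.
have beta64 : beta <= 64^-1.
  apply: (le_trans first_row_bound).
  by rewrite expr2 (le_trans (ler_pM (ltW _) (ltW _) kappa_le kappa_le))//; lra.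
have qb : q <= 8^-1 * beta.
  apply: (le_trans (ler_norm _)); apply: (le_trans (bnd0 _)).
  by rewrite -/beta ler_wpM2r.
have kq : k * q <= 8 / 3 * (8^-1 * beta).
  apply: (@le_trans _ _ (k * (8^-1 * beta))); first by rewrite ler_wpM2l.
  by rewrite ler_wpM2r// mulr_ge0.
have kb : k * beta <= 8 / 3 * beta by rewrite ler_wpM2r.
have kb2 : k ^+ 2 * beta ^+ 2 <= 9^-1 * beta.
  rewrite -exprMn expr2.
  apply: (@le_trans _ _ ((8 / 3 * 64^-1) * (8 / 3 * beta))); last by lra.
  have kb0 : 0 <= k * beta by rewrite mulr_ge0.
  by apply: ler_pM => //; apply: (le_trans kb); lra.
(* What remains is [k beta + 6 k q + 3 k^2 beta^2 <= 6 beta]; the left side is at most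
   [(8/3 + 2 + 1/3) beta = 5 beta]. *)
lra.
Qed.

End FirstVariable.

End QuadraticForms.

(** * Exponential moment by successive integration *)

Section QuadraticMGF.
Context d (T : measurableType d) {R : realType} (P : probability T R).

Lemma measurable_quad (I : finType) (A : I -> I -> R) d' (S : measurableType d')
    (x : I -> S -> R) :
  (forall i, measurable_fun setT (x i)) ->
  measurable_fun setT (fun s => quad A (fun i => x i s)).
Proof.
move=> mx; apply: measurable_sum => i; apply: measurable_sum => j.
by apply: measurable_funM => //; apply: measurable_funM.
Qed.

(** After squaring, [expR x >= 1 + x] reduces this to [(1 + 2 a + 6 a^2) (1 - 2 a) = 1 + a^2 (2 - 12
    a) >= 1]. *)
Lemma inv_sqrt_le_expR (a : R) : a <= 8^-1 ->
  (Num.sqrt (1 - 2 * a))^-1 <= expR (a + 3 * a ^+ 2).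
Proof.
move=> a8; have p0 : 0 < 1 - 2 * a by lra.
rewrite -ler_sqr ?nnegrE ?invr_ge0 ?sqrtr_ge0 ?expR_ge0//.
rewrite exprVn sqr_sqrtr; last exact: ltW.
rewrite -expRM_natl.
apply: (@le_trans _ _ (1 + 2%:R * (a + 3 * a ^+ 2))); last exact: expR_ge1Dx.
rewrite -[leLHS]mul1r ler_pdivrMr//.
have -> : (1 + 2%:R * (a + 3 * a ^+ 2)) * (1 - 2 * a) =
  1 + a ^+ 2 * (2 - 12 * a) by ring.
by rewrite lerDl; apply: mulr_ge0; [exact: sqr_ge0|lra].
Qed.

(** Induction on the number of variables: integrating the first one leaves the factor
    [s = (1 - 2 a)^(-1/2)] and the Schur form, which satisfies the same hypotheses. *)
Lemma integral_expR_quad_ord (E : set T) N (A : 'I_N -> 'I_N -> R)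
    (X : 'I_N -> T -> R) :
  (forall i j, A i j = A j i) ->
  (forall x, `|quad A x| <= 8^-1 * \sum_i x i ^+ 2) ->
  measurable E -> (forall i, measurable_fun setT (X i)) -> indep_normal P E X ->
  (\int[P]_(w in E) (expR (quad A (fun i => X i w)))%:E <=
   P E * (expR (trace A + 3 * frob A))%:E)%E.
Proof.
move=> symA bndA mE; elim: N => [|N IH] in A X symA bndA * => mX iX.
  rewrite /trace /frob !big_ord0 mulr0 addr0 expR0 mule1.
  under eq_integral do rewrite /quad big_ord0 expR0.
  by rewrite integral_cst// mul1e.
set X' := fun i => X (lift ord0 i).
set a := A ord0 ord0; set b := fun i => A ord0 (lift ord0 i).
pose A0 i j := A (lift ord0 i) (lift ord0 j).
pose f (y : R) (x : 'I_N -> R) :=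
  expR (a * y ^+ 2 + 2 * y * (\sum_i b i * x i) + quad A0 x).
have piv : 3 / 4 <= 1 - 2 * a by exact: (first_pivot_gt0 symA (lexx _) bndA).
have p0 : 0 < 1 - 2 * a by lra.
pose s := (Num.sqrt (1 - 2 * a))^-1.
have s0 : 0 < s by rewrite invr_gt0 sqrtr_gt0.
have s2 : s ^+ 2 = (1 - 2 * a)^-1 by rewrite exprVn sqr_sqrtr// ltW.
under eq_integral do rewrite quad_recl//.
have mf d' (S : measurableType d') (y : S -> R)
     (x : 'I_N -> S -> R) :
     measurable_fun setT y -> (forall i, measurable_fun setT (x i)) ->
     measurable_fun setT (fun s => f (y s) (fun i => x i s)).
  move=> my mx; apply: measurableT_comp => //.
  apply: measurable_funD; last exact: measurable_quad.
  apply: measurable_funD.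
    by apply: measurable_funM => //; exact: measurable_funX.
  apply: measurable_funM; first exact: measurable_funM.
  by apply: measurable_sum => i; apply: measurable_funM.
have := integral_indep_normal mE mX iX mf (fun _ _ => expR_ge0 _).
rewrite /f /= => ->.
under eq_integral => w _.
  rewrite (_ : (\int[_]_y _)%E =
      (s%:E * (expR (quad (schur A) (fun i => X' i w)))%:E)%E); last first.
    set c := \sum_i _; set q := quad _ _.
    under eq_integral => y _.
      (* Since [s ^- 2 = 1 - 2 a], the coefficient [(1 - s ^- 2) / 2] is [a]. *)
      rewrite (_ : _ + q = q + ((1 - s ^- 2) / 2 * y ^+ 2 + 2 * c * y)); last first.
        by rewrite s2 invrK; move: (a) (c) (q) => u v z; field.
      rewrite expRD EFinM; over.
    rewrite ge0_integralZl//.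
    - rewrite integral_expR_quadratic_normal// -!EFinM; congr (_%:E).
      rewrite mulrCA -expRD quad_schur// s2; congr (_ * expR (_ + _)).
      exact: mulrAC.
    - apply/measurable_EFinP; apply: measurableT_comp => //.
      by apply: measurable_funD; apply: measurable_funM => //; exact: measurable_funX.
  over.
have mS : measurable_fun E (fun w => (expR (quad (schur A) (fun i => X' i w)))%:E).
  apply: measurable_funTS; apply/measurable_EFinP; apply: measurableT_comp => //.
  by apply: measurable_quad => i; exact: mX.
rewrite ge0_integralZl//; last by rewrite lee_fin ltW.
have symA' i j : schur A i j = schur A j i.
  by rewrite /schur symA [X in _ + _ * X]mulrC.
have bndA' : forall x, `|quad (schur A) x| <= 8^-1 * \sum_i x i ^+ 2.
  exact: (schur_bound symA (lexx _) bndA).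
have {}IH := IH _ X' symA' bndA' (fun i => mX _) (indep_normal_lift iX).
apply: (@le_trans _ _ (s%:E *
    (P E * (expR (trace (schur A) + 3 * frob (schur A)))%:E))%E).
  by rewrite lee_pmul2l// lte_fin.
rewrite muleCA lee_wpmul2l// -EFinM lee_fin.
(* The factor [s] costs [a + 3 a^2] in the exponent, which the decrease of trace plus three times
   [frob] pays for. *)
apply: (@le_trans _ _ (expR (a + 3 * a ^+ 2) *
    expR (trace (schur A) + 3 * frob (schur A)))).
  rewrite ler_wpM2r ?expR_ge0// inv_sqrt_le_expR//; lra.
rewrite -expRD ler_expR.
by apply: (trace_frob_schur symA _ (lexx _) bndA); rewrite invr_gt0.
Qed.

Lemma integral_expR_quad (E : set T) (I : finType) (A : I -> I -> R)
    (X : I -> T -> R) :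
  (forall i j, A i j = A j i) ->
  (forall x, `|quad A x| <= 8^-1 * \sum_i x i ^+ 2) ->
  measurable E -> (forall i, measurable_fun setT (X i)) -> indep_normal P E X ->
  (\int[P]_(w in E) (expR (quad A (fun i => X i w)))%:E <=
   P E * (expR (trace A + 3 * frob A))%:E)%E.
Proof.
move=> symA bndA mE mX iX.
have reix (F : I -> R) : \sum_i F i = \sum_(k < #|I|) F (enum_val k).
  by rewrite (reindex (@enum_val I predT))//; exact/onW_bij/enum_val_bij.
pose A' (k l : 'I_#|I|) := A (enum_val k) (enum_val l).
have quadE x : quad A x = quad A' (fun k => x (enum_val k)).
  by rewrite /quad reix; apply: eq_bigr => k _; rewrite reix.
have -> : trace A = trace A' by rewrite /trace reix.
have -> : frob A = frob A'.
  by rewrite /frob reix; apply: eq_bigr => k _; rewrite reix.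
under eq_integral do rewrite quadE.
apply: (integral_expR_quad_ord _ _ mE _ (indep_normal_enum iX)) => //.
- by move=> k l; exact: symA.
- move=> x; have := bndA (fun i => x (enum_rank i)); rewrite quadE reix.
  have -> : (fun k : 'I_#|I| => x (enum_rank (enum_val k))) = x.
    by apply/funext => k; rewrite enum_valK.
  by under eq_bigr do rewrite enum_valK.
Qed.

End QuadraticMGF.

(** * Quadratic forms composed with a linear map *)

Section LinearImage.
Context {R : realFieldType}.
Variables (O I : finType) (M : O -> O -> R) (L : O -> I -> R).

(** The matrix [L^T M L]. *)
Definition congruent (i j : I) : R := \sum_a \sum_b M a b * (L a i * L b j).

Lemma quad_congruent x :
  quad congruent x = quad M (fun a => \sum_i L a i * x i).
Proof.
rewrite /quad /congruent.
under [RHS]eq_bigr => a _ do under eq_bigr => b _ do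
  rewrite big_distrlr /= mulr_sumr.
under [RHS]eq_bigr => a _ do rewrite exchange_big /=.
rewrite [RHS]exchange_big /=; apply: eq_bigr => i _.
under [RHS]eq_bigr => a _ do under eq_bigr => b _ do rewrite mulr_sumr.
under [RHS]eq_bigr => a _ do rewrite exchange_big /=.
rewrite [RHS]exchange_big /=; apply: eq_bigr => j _.
rewrite mulr_suml; apply: eq_bigr => a _; rewrite mulr_suml.
by apply: eq_bigr => b _; ring.
Qed.

Lemma trace_congruent :
  trace congruent = \sum_a \sum_b M a b * (\sum_i L a i * L b i).
Proof.
rewrite /trace /congruent exchange_big; apply: eq_bigr => a _ /=.
rewrite exchange_big; apply: eq_bigr => b _ /=.
by rewrite mulr_sumr.
Qed.

(** The bound on [L^T] is applied to each column of [M L], then to each row of [M]. *)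
Lemma frob_congruent (k : R) : 0 <= k ->
  (forall y, \sum_i (\sum_a L a i * y a) ^+ 2 <= k * \sum_a y a ^+ 2) ->
  frob congruent <= k ^+ 2 * frob M.
Proof.
move=> k0 Lk; rewrite /frob exchange_big /=.
apply: (@le_trans _ _ (\sum_j k * \sum_a (\sum_b L b j * M a b) ^+ 2)).
  apply: ler_sum => j _; apply: le_trans (Lk _).
  rewrite le_eqVlt; apply/orP; left; apply/eqP.
  apply: eq_bigr => i _; congr (_ ^+ 2); apply: eq_bigr => a _.
  by rewrite mulr_sumr; apply: eq_bigr => b _; ring.
rewrite -mulr_sumr expr2 -mulrA ler_wpM2l// exchange_big /= mulr_sumr.
by apply: ler_sum => a _; exact: Lk.
Qed.

End LinearImage.

(** * Mismatched vertices and broken edge pairs *)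

Section MismatchCounting.
Local Close Scope classical_set_scope.
Variable n : nat.

Lemma edge_actM (s t : 'S_n) e : edge_act (s * t)%g e = edge_act t (edge_act s e).
Proof.
apply: val_inj => /=; rewrite -imset_comp.
by apply: eq_imset => x; rewrite /= permM.
Qed.

Lemma edge_act1 (e : edge n) : edge_act 1%g e = e.
Proof.
apply: val_inj => /=; rewrite -[RHS]imset_id.
by apply: eq_imset => x; rewrite perm1.
Qed.

Lemma edge_actK (s : 'S_n) : cancel (edge_act s) (edge_act s^-1%g).
Proof. by move=> e; rewrite -edge_actM mulgV edge_act1. Qed.

Lemma edge_actKV (s : 'S_n) : cancel (edge_act s^-1%g) (edge_act s).
Proof. by move=> e; rewrite -edge_actM mulVg edge_act1. Qed.

(* If s u != u, the edge {u, v} is moved by s unless v is u or s u. *)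
Lemma moved_edges_at (s : 'S_n) (u : 'I_n) : s u != u ->
  (n - 2 <= #|[set e : edge n | (edge_act s e != e) && (u \in val e)]|)%N.
Proof.
move=> su; set D := [set e | _].
(* For an edge at [u] this is its other endpoint; the default is never reached. The image of [D]
   covers every vertex but [u] and [s u]. *)
pose other (e : edge n) : 'I_n := odflt u [pick v in val e :\ u].
have cardC : (n - 2 <= #|~: [set u; s u]|)%N.
  by rewrite cardsCs finset.setCK card_ord cards2 eq_sym su.
apply: (leq_trans cardC); apply: leq_trans (leq_imset_card other D).
apply/subset_leq_card/fintype.subsetP => v; rewrite !inE negb_or => /andP[vu vsu].
have e2 : #|[set u; v]| == 2%N by rewrite cards2 (eq_sym u) vu.
apply/imsetP; exists (Sub [set u; v] e2 : edge n); last first.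
  rewrite /other SubK; case: pickP => [w|/(_ v)].
    by rewrite !inE => /andP[/negPf ->] /= /eqP.
  by rewrite !inE vu eqxx orbT.
rewrite inE SubK in_set2 eqxx andbT; apply/eqP => /(congr1 val).
rewrite /= => suv.
have : s u \in s @: [set u; v] by rewrite imset_f// in_set2 eqxx.
by rewrite suv in_set2 (negPf su) eq_sym (negPf vsu).
Qed.

(** Double counting of incidences: a moved edge has two endpoints, and a moved vertex lies on at
    least [n - 2] moved edges. *)
Lemma moved_edges (s : 'S_n) :
  (#|[set u | s u != u]| * (n - 2) <= 2 * #|[set e : edge n | edge_act s e != e]|)%N.
Proof.
have -> : (2 * #|[set e : edge n | edge_act s e != e]| =
    \sum_(u < n) #|[set e : edge n | (edge_act s e != e) && (u \in val e)]|)%N.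
  transitivity (\sum_(e : edge n | edge_act s e != e) \sum_(u in val e) 1)%N.
    rewrite (eq_bigr (fun=> 2%N)).
      by rewrite sum_nat_const cardsE mulnC.
    by move=> e _; rewrite sum1_card (eqP (valP e)).
  rewrite (exchange_big_dep predT)//=; apply: eq_bigr => u _.
  by rewrite sum1_card cardsE.
rewrite -sum_nat_const big_mkcond /=.
apply: leq_sum => u _; rewrite inE; case: ifP => // su.
exact: moved_edges_at.
Qed.

Variable p : nat.
Implicit Types s t : perm_tuple n p.

Definition same_image t (a b : 'I_p * edge n) : bool :=
  edge_act (t a.1) a.2 == edge_act (t b.1) b.2.

Definition broken_pairs s t : nat :=
  \sum_(a : 'I_p * edge n) \sum_(b : 'I_p * edge n)
    (same_image s a b && ~~ same_image t a b).

Definition mismatches t s (psi : 'S_n) : nat :=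
  \sum_(j < p) \sum_(u < n) (psi (t j u) != s j u).

(** This is the identity exactly when [t] relabels coordinates [j] and [j'] of [s] in the same
    way. *)
Let rel_perm s t j j' : 'S_n :=
  ((s j)^-1 * t j * ((s j')^-1 * t j')^-1)%g.

(** For fixed [j] and [j'], a pair matched by [s] is determined by its common image [f], and [t]
    breaks it exactly when [rel_perm] moves [f]. *)
Lemma broken_pairs_moved s t : broken_pairs s t =
  (\sum_(j < p) \sum_(j' < p)
     #|[set e : edge n | edge_act (rel_perm s t j j') e != e]|)%N.
Proof.
have pairE (F : 'I_p * edge n -> nat) :
    (\sum_a F a = \sum_(j < p) \sum_(e : edge n) F (j, e))%N.
  by rewrite pair_bigA /=; apply: eq_bigr => -[].
rewrite /broken_pairs pairE; apply: eq_bigr => j _.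
under eq_bigr => e _ do rewrite pairE.
rewrite exchange_big /=; apply: eq_bigr => j' _.
rewrite (reindex_inj (can_inj (edge_actKV (s j)))) /=.
rewrite -sum1_card [RHS]big_mkcond /=; apply: eq_bigr => f _.
pose f' := edge_act (s j')^-1%g f.
rewrite (bigD1 f')//= big1 ?addn0; last first.
  move=> e' e'N; rewrite /same_image /= edge_actKV.
  case: eqP => //= fe'; move: e'N.
  by rewrite /f' fe' edge_actK eqxx.
rewrite /same_image /= /f' !edge_actKV eqxx /= inE.
rewrite /rel_perm edge_actM (can2_eq (edge_actKV _) (edge_actK _)) !edge_actM.
by case: eqP.
Qed.

(** For fixed [j'], the vertices moved by [rel_perm s t j j'], summed over [j], count the mismatches
    after the relabelling that matches coordinate [j'] exactly. Each of the [p] choices of [j'] thus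
    contributes at least [d]. *)
Lemma broken_pairs_ge s t d : (forall psi, (d <= mismatches t s psi)%N) ->
  (p * d * (n - 2) <= 2 * broken_pairs s t)%N.
Proof.
move=> dt; rewrite broken_pairs_moved.
apply: (@leq_trans (\sum_(j < p) \sum_(j' < p)
    #|[set x | rel_perm s t j j' x != x]| * (n - 2))%N); last first.
  rewrite big_distrr; apply: leq_sum => j _ /=.
  by rewrite big_distrr; apply: leq_sum => j' _; exact: moved_edges.
rewrite exchange_big /=.
under eq_bigr do rewrite -big_distrl /=.
rewrite -big_distrl leq_mul2r; apply/orP; right => /=.
rewrite -[X in (X * d)%N]card_ord -sum_nat_const; apply: leq_sum => j' _.
apply: leq_trans (dt ((s j')^-1 * t j')^-1%g) _; rewrite /mismatches.
rewrite leq_eqVlt; apply/orP; left; apply/eqP; apply: eq_bigr => j _.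
rewrite (reindex_inj (@perm_inj _ (s j)^-1%g)) -sum1_card [RHS]big_mkcond /=.
apply: eq_bigr => x _; rewrite inE /rel_perm permKV !permM.
by case: eqP.
Qed.

End MismatchCounting.

(** * The alignment score as a quadratic form *)

Section ScoreQuadraticForm.
Context {R : realType}.
Variables n p : nat.
Local Notation obs := ('I_p * edge n)%type.
Local Notation latent := (edge n + obs)%type.
Implicit Types (s t : perm_tuple n p) (y : obs -> R).

Definition same_imageR t (a b : obs) : R := (same_image t a b)%:R.

Definition aligned_sum t y (f : edge n) : R := \sum_(j < p) y (j, edge_act (t j)^-1%g f).

Lemma sum_obs (F : obs -> R) : \sum_a F a = \sum_(j < p) \sum_(e : edge n) F (j, e).
Proof. by rewrite pair_bigA /=; apply: eq_bigr => -[]. Qed.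

Lemma alignment_score_quad (g : observation R n p) t :
  alignment_score g t = quad (same_imageR t) (fun a => g a.1 a.2).
Proof.
rewrite /quad sum_obs /alignment_score; apply: eq_bigr => j _.
rewrite exchange_big /=; apply: eq_bigr => e _.
by rewrite sum_obs.
Qed.

Lemma same_imageR_sum t (y : obs -> R) (a : obs) :
  \sum_b same_imageR t a b * y b = aligned_sum t y (edge_act (t a.1) a.2).
Proof.
rewrite sum_obs; apply: eq_bigr => j _.
rewrite (bigD1 (edge_act (t j)^-1%g (edge_act (t a.1) a.2)))//= big1 ?addr0.
  by rewrite /same_imageR /same_image /= edge_actKV eqxx mul1r.
move=> e eN; rewrite /same_imageR /same_image /=; case: eqP => [te|_];
  last by rewrite mul0r.
by move: eN; rewrite te edge_actK eqxx.
Qed.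

Lemma sum_edge_act t (F : edge n -> obs -> R) :
  \sum_(a : obs) F (edge_act (t a.1) a.2) a =
  \sum_f \sum_(j < p) F f (j, edge_act (t j)^-1%g f).
Proof.
rewrite sum_obs [RHS]exchange_big /=; apply: eq_bigr => j _.
rewrite (reindex_inj (can_inj (edge_actKV (t j)))) /=.
by apply: eq_bigr => f _; rewrite edge_actKV.
Qed.

(** The relation [same_image t] is an equivalence whose classes, one per image edge [f], have one
    element for each coordinate; the form is the sum of the squared class sums. *)
Lemma quad_same_imageR t y : quad (same_imageR t) y = \sum_f aligned_sum t y f ^+ 2.
Proof.
rewrite /quad.
transitivity (\sum_a y a * aligned_sum t y (edge_act (t a.1) a.2)).
  apply: eq_bigr => a _; rewrite -same_imageR_sum mulr_sumr.
  by apply: eq_bigr => b _; ring.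
rewrite (sum_edge_act t (fun f a => y a * aligned_sum t y f)).
by apply: eq_bigr => f _; rewrite -mulr_suml expr2.
Qed.

Lemma sqr_sum_le (z : 'I_p -> R) : (\sum_j z j) ^+ 2 <= p%:R * \sum_j z j ^+ 2.
Proof.
rewrite sqr_sum.
apply: (@le_trans _ _ (\sum_j \sum_k (z j ^+ 2 / 2 + z k ^+ 2 / 2))).
  apply: ler_sum => j _; apply: ler_sum => k _.
  have := sqr_ge0 (z j - z k); nra.
under eq_bigr do rewrite big_split /= sumr_const card_ord.
rewrite big_split /= sumr_const card_ord sumrMnl -mulrnDl -big_split /= -[leLHS]mulr_natl.
rewrite le_eqVlt; apply/orP; left; apply/eqP; congr (_ * _).
by apply: eq_bigr => j _; field.
Qed.

Lemma quad_same_imageR_ge0 t y : 0 <= quad (same_imageR t) y.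
Proof. by rewrite quad_same_imageR; apply: sumr_ge0 => f _; exact: sqr_ge0. Qed.

Lemma quad_same_imageR_le t y : quad (same_imageR t) y <= p%:R * \sum_a y a ^+ 2.
Proof.
rewrite quad_same_imageR (sum_edge_act t (fun=> fun a => y a ^+ 2)) mulr_sumr.
by apply: ler_sum => f _; exact: sqr_sum_le.
Qed.

(** The total does not depend on [t], so a competitor gains as many matched pairs as it loses. *)
Lemma sum_same_imageR t : \sum_a \sum_b same_imageR t a b = #|{: edge n}|%:R * p%:R ^+ 2.
Proof.
have -> : \sum_a \sum_b same_imageR t a b = quad (same_imageR t) (fun=> 1).
  by apply: eq_bigr => a _; apply: eq_bigr => b _; rewrite !mulr1.
rewrite quad_same_imageR; under eq_bigr do rewrite /aligned_sum sumr_const card_ord.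
by rewrite sumr_const mulr_natl.
Qed.

Variable rho : R.
Hypotheses (rho_ge0 : 0 <= rho) (rho_le1 : rho <= 1) (rho_p : rho * p%:R <= 1).

(** The linear map from the latent variables to the observations when [pistar] is [s]. *)
Definition loading s (a : obs) (i : latent) : R :=
  match i with
  | inl f => Num.sqrt rho * (edge_act (s a.1) a.2 == f)%:R
  | inr b => Num.sqrt (1 - rho) * (a == b)%:R
  end.

Let sqr_rho : Num.sqrt rho ^+ 2 = rho. Proof. exact: sqr_sqrtr. Qed.

Let sqr_1rho : Num.sqrt (1 - rho) ^+ 2 = 1 - rho.
Proof. by apply: sqr_sqrtr; rewrite subr_ge0. Qed.

Lemma sum_delta (I : finType) (i0 : I) (F : I -> R) :
  \sum_i (i0 == i)%:R * F i = F i0.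
Proof.
rewrite (bigD1 i0)//= eqxx mul1r big1 ?addr0// => i.
by rewrite eq_sym => /negPf ->; rewrite mul0r.
Qed.

Definition latent_obs s (x : latent -> R) : observation R n p := fun j e =>
  Num.sqrt rho * x (inl (edge_act (s j) e)) + Num.sqrt (1 - rho) * x (inr (j, e)).

Lemma loading_sum s (x : latent -> R) (a : obs) : \sum_i loading s a i * x i =
  Num.sqrt rho * x (inl (edge_act (s a.1) a.2)) + Num.sqrt (1 - rho) * x (inr a).
Proof.
rewrite big_sumType /=; congr (_ + _).
  under eq_bigr do rewrite -mulrA.
  by rewrite -mulr_sumr sum_delta.
under eq_bigr do rewrite -mulrA.
by rewrite -mulr_sumr sum_delta.
Qed.

(** Each shared variable enters [p] observations with squared weight [rho], and [rho p <= 1]; the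
    factor 2 comes from squaring a sum of two terms. *)
Lemma loading_norm s (x : latent -> R) :
  \sum_a (\sum_i loading s a i * x i) ^+ 2 <= 2 * \sum_i x i ^+ 2.
Proof.
under eq_bigr do rewrite loading_sum.
apply: (@le_trans _ _ (\sum_a (2 * rho * x (inl (edge_act (s a.1) a.2)) ^+ 2 +
    2 * (1 - rho) * x (inr a) ^+ 2))).
  apply: ler_sum => a _.
  move: (x (inl _)) (x (inr _)) (Num.sqrt rho) sqr_rho (Num.sqrt _) sqr_1rho.
  move=> h z u <- v <-; have := sqr_ge0 (u * h - v * z); nra.
rewrite big_split /= big_sumType /= [leRHS]mulrDr; apply: lerD.
  rewrite (sum_edge_act s (fun f _ => 2 * rho * x (inl f) ^+ 2)).
  rewrite mulr_sumr; apply: ler_sum => f _.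
  rewrite sumr_const card_ord -[leLHS]mulr_natl.
  have -> : p%:R * (2 * rho * x (inl f) ^+ 2) = rho * p%:R * (2 * x (inl f) ^+ 2).
    by ring.
  by rewrite ler_piMl// mulr_ge0// sqr_ge0.
rewrite mulr_sumr; apply: ler_sum => b _.
by have := sqr_ge0 (x (inr b)); move: rho_ge0; nra.
Qed.

(** The shared variables contribute [rho] times the form of [same_imageR s], at most [rho p <= 1]
    times the squared norm, and the noise at most once that norm. *)
Lemma loading_tr_norm s (y : obs -> R) :
  \sum_i (\sum_a loading s a i * y a) ^+ 2 <= 2 * \sum_a y a ^+ 2.
Proof.
rewrite big_sumType /=.
have foldE f : \sum_a Num.sqrt rho * (edge_act (s a.1) a.2 == f)%:R * y a =
    Num.sqrt rho * aligned_sum s y f.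
  under eq_bigr do rewrite -mulrA; rewrite -mulr_sumr; congr (_ * _).
  rewrite (sum_edge_act s (fun e a => (e == f)%:R * y a)).
  under eq_bigr => e _ do rewrite -mulr_sumr eq_sym.
  by rewrite sum_delta.
have idE b : \sum_a Num.sqrt (1 - rho) * (a == b)%:R * y a = Num.sqrt (1 - rho) * y b.
  under eq_bigr => a _ do rewrite -mulrA eq_sym.
  by rewrite -mulr_sumr sum_delta.
under eq_bigr do rewrite foldE exprMn sqr_rho.
under [X in _ + X <= _]eq_bigr do rewrite idE exprMn sqr_1rho.
rewrite -!mulr_sumr -quad_same_imageR.
have y0 : 0 <= \sum_a y a ^+ 2 by apply: sumr_ge0 => a _; exact: sqr_ge0.
apply: (@le_trans _ _ (rho * (p%:R * \sum_a y a ^+ 2) + 1 * \sum_a y a ^+ 2)).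
  by apply: lerD; rewrite ?ler_wpM2l ?quad_same_imageR_le// ler_wpM2r// gerBl.
rewrite mulrA -mulrDl ler_wpM2r//; move: rho_p; lra.
Qed.

Lemma loading_cov s (a b : obs) :
  \sum_i loading s a i * loading s b i =
  rho * same_imageR s a b + (1 - rho) * (a == b)%:R.
Proof.
rewrite loading_sum /loading !mulrA -!expr2 sqr_rho sqr_1rho.
by rewrite /same_imageR /same_image eq_sym (eq_sym b).
Qed.

Variables s t : perm_tuple n p.

Let K : R := (broken_pairs s t)%:R.

(** The Chernoff parameter [rho / 48] is part of the matrix. *)
Definition score_diff (a b : obs) : R :=
  rho / 48 * (same_imageR t a b - same_imageR s a b).

Lemma broken_pairsE : K = \sum_a \sum_b same_imageR s a b * (1 - same_imageR t a b).
Proof.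
rewrite /K /broken_pairs natr_sum; apply: eq_bigr => a _.
rewrite natr_sum; apply: eq_bigr => b _.
by rewrite /same_imageR; do 2 case: same_image;
  rewrite /= ?subrr ?subr0 ?mul0r ?mulr0 ?mulr1.
Qed.

(** The two score matrices agree on the diagonal, so the noise part of the covariance drops out. The
    shared part sees only pairs matched by [s], where the difference is [-1] on broken pairs and 0
    otherwise. *)
Lemma score_diff_cov :
  \sum_a \sum_b score_diff a b * (\sum_i loading s a i * loading s b i) =
  - (rho ^+ 2 / 48 * K).
Proof.
rewrite broken_pairsE mulr_sumr -sumrN; apply: eq_bigr => a _.
rewrite mulr_sumr -sumrN; apply: eq_bigr => b _.
rewrite loading_cov /score_diff.
have sim2 : same_imageR s a b * same_imageR s a b = same_imageR s a b.
  by rewrite /same_imageR; case: same_image; rewrite ?mul0r ?mul1r.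
have -> : rho / 48 * (same_imageR t a b - same_imageR s a b) *
    (rho * same_imageR s a b + (1 - rho) * (a == b)%:R) =
  rho ^+ 2 / 48 * (same_imageR s a b * same_imageR t a b -
                   same_imageR s a b * same_imageR s a b) +
  rho / 48 * (1 - rho) * ((same_imageR t a b - same_imageR s a b) * (a == b)%:R) by ring.
have -> : (same_imageR t a b - same_imageR s a b) * (a == b)%:R = 0.
  by case: eqP => [->|_]; rewrite /same_imageR /same_image ?eqxx ?subrr ?mul0r ?mulr0.
by rewrite sim2; ring.
Qed.

(** The nonzero entries sit at the [K] pairs lost and at the equally many pairs gained. *)
Lemma frob_score_diff : frob score_diff = (rho / 48) ^+ 2 * (2 * K).
Proof.
have -> : 2 * K =
    2 * K + \sum_a \sum_b same_imageR t a b - \sum_a \sum_b same_imageR s a b.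
  by rewrite !sum_same_imageR addrK.
rewrite broken_pairsE mulr_sumr -big_split -sumrB mulr_sumr.
apply: eq_bigr => a _ /=; rewrite mulr_sumr -big_split -sumrB mulr_sumr.
apply: eq_bigr => b _ /=; rewrite /score_diff exprMn; congr (_ * _).
by rewrite /same_imageR; do 2 case: same_image => /=; ring.
Qed.

Lemma quad_score_diff y :
  quad score_diff y = rho / 48 * (quad (same_imageR t) y - quad (same_imageR s) y).
Proof.
rewrite /quad -sumrB mulr_sumr; apply: eq_bigr => a _.
by rewrite -sumrB mulr_sumr; apply: eq_bigr => b _; rewrite /score_diff; ring.
Qed.

(** Both forms lie between 0 and [p] times the squared norm, and [rho p <= 1]. Composing with
    [loading] doubles [1/16] to the required [1/8]. *)
Lemma score_diff_bound y : `|quad score_diff y| <= 16^-1 * \sum_a y a ^+ 2.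
Proof.
have y0 : 0 <= \sum_a y a ^+ 2 by apply: sumr_ge0 => a _; exact: sqr_ge0.
rewrite quad_score_diff normrM ger0_norm ?divr_ge0//.
apply: (@le_trans _ _ (rho / 48 * (p%:R * \sum_a y a ^+ 2))).
  rewrite ler_wpM2l ?divr_ge0// ler_norml.
  have := quad_same_imageR_ge0 t y; have := quad_same_imageR_ge0 s y.
  have := quad_same_imageR_le t y; have := quad_same_imageR_le s y; lra.
have -> : rho / 48 * (p%:R * \sum_a y a ^+ 2) = rho * p%:R * (48^-1 * \sum_a y a ^+ 2).
  by ring.
apply: (@le_trans _ _ (1 * (48^-1 * \sum_a y a ^+ 2))); last by lra.
by rewrite ler_wpM2r// mulr_ge0.
Qed.

Context d (T : measurableType d) (P : probability T R).

Lemma integral_expR_score_diff (E : set T) (X : latent -> T -> R) :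
  measurable E -> (forall i, measurable_fun setT (X i)) -> indep_normal P E X ->
  (\int[P]_(w in E)
     (expR (rho / 48 * (alignment_score (latent_obs s (fun i => X i w)) t -
                        alignment_score (latent_obs s (fun i => X i w)) s)))%:E <=
   P E * (expR (- (rho ^+ 2 / 96 * K)))%:E)%E.
Proof.
move=> mE mX iX; pose g w := latent_obs s (fun i => X i w).
pose A := congruent score_diff (loading s).
have gE w : rho / 48 * (alignment_score (g w) t - alignment_score (g w) s) =
    quad A (fun i => X i w).
  rewrite quad_congruent !alignment_score_quad -quad_score_diff; congr quad.
  by apply/funext => -[j e]; rewrite loading_sum.
under eq_integral do rewrite -/(g _) gE.
have symM a b : score_diff a b = score_diff b a.
  rewrite /score_diff /same_imageR /same_image (eq_sym (edge_act (t a.1) _)).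
  by rewrite (eq_sym (edge_act (s a.1) _)).
have symA i j : A i j = A j i.
  rewrite /A /congruent exchange_big; apply: eq_bigr => a _ /=.
  by apply: eq_bigr => b _; rewrite symM; congr (_ * _); exact: mulrC.
have bndA x : `|quad A x| <= 8^-1 * \sum_i x i ^+ 2.
  rewrite quad_congruent; apply: (le_trans (score_diff_bound _)).
  by have := loading_norm s x; lra.
apply: (le_trans (integral_expR_quad symA bndA mE mX iX)).
rewrite lee_wpmul2l// lee_fin ler_expR trace_congruent score_diff_cov.
(* The trace is [- rho^2 K / 48], and three times [frob] is at most
   [3 * 4 * 2 K rho^2 / 2304 = rho^2 K / 96]. *)
have := frob_congruent score_diff (ler0n R 2) (loading_tr_norm s).
rewrite frob_score_diff /A; have -> : (rho / 48) ^+ 2 = rho ^+ 2 / 2304 by field.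
by rewrite -/A; set F := frob A; move: (rho ^+ 2) => r; lra.
Qed.

End ScoreQuadraticForm.

(** * Union bound *)

Section UnionBound.
Context {R : realType}.

Lemma sum_perm_le_ffun n (F : {ffun 'I_n -> 'I_n} -> R) :
  (forall f, 0 <= F f) -> \sum_(s : 'S_n) F (pval s) <= \sum_f F f.
Proof.
move=> F0; rewrite -(@big_imset _ _ _ _ _ (@pval _) predT F) /=; last first.
  by move=> s t _ _; exact: val_inj.
rewrite big_mkcond /=; apply: ler_sum => f _; by case: ifP.
Qed.

(** The sum factorises over coordinates; enlarging permutations to arbitrary functions makes it
    factorise over vertices too, each factor being [1 + (n - 1) q]. *)
Lemma sum_expr_mismatches n p (s : perm_tuple n p) (q : R) : 0 <= q ->
  \sum_(t : perm_tuple n p) q ^+ mismatches t s 1%g <= (1 + n%:R * q) ^+ (n * p).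
Proof.
move=> q0.
have -> : \sum_(t : perm_tuple n p) q ^+ mismatches t s 1%g =
    \prod_(j < p) \sum_(r : 'S_n) \prod_(u < n) q ^+ (r u != s j u).
  rewrite bigA_distr_bigA; apply: eq_bigr => t _; rewrite /mismatches.
  rewrite expr_sum; apply: eq_bigr => j _; rewrite expr_sum.
  by apply: eq_bigr => u _; rewrite perm1.
have -> : (1 + n%:R * q) ^+ (n * p) = \prod_(j < p) (1 + n%:R * q) ^+ n.
  by rewrite prodr_const card_ord exprM.
apply: ler_prod => j _.
apply/andP; split.
  by apply: sumr_ge0 => r _; apply: prodr_ge0 => u _; rewrite exprn_ge0.
apply: (@le_trans _ _
    (\sum_(f : {ffun 'I_n -> 'I_n}) \prod_(u < n) q ^+ (f u != s j u))).
  under eq_bigr => r _ do under eq_bigr => u _ do rewrite -pvalE.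
  apply: (sum_perm_le_ffun (F := fun f => \prod_(u < n) q ^+ (f u != s j u))).
  by move=> f; apply: prodr_ge0 => u _; rewrite exprn_ge0.
rewrite -(bigA_distr_bigA (fun u v => q ^+ (v != s j u))).
have -> : (1 + n%:R * q) ^+ n = \prod_(u < n) (1 + n%:R * q).
  by rewrite prodr_const card_ord.
apply: ler_prod => u _.
apply/andP; split; first by apply: sumr_ge0 => v _; rewrite exprn_ge0.
rewrite (bigD1 (s j u))//= eqxx expr0 lerD2l.
apply: (@le_trans _ _ (\sum_(v < n | v != s j u) q)).
  by apply: ler_sum => v /= vN; rewrite vN expr1.
have -> : n%:R * q = \sum_(v < n) q by rewrite sumr_const card_ord mulr_natl.
by rewrite big_mkcond; apply: ler_sum => v _; case: ifP.
Qed.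

Lemma expR_le_inv (x : R) : x < 1 -> expR x <= (1 - x)^-1.
Proof.
move=> x1; rewrite -[x]opprK expRN opprK lef_pV2 ?posrE ?expR_gt0 ?subr_gt0//.
exact: expR_ge1Dx.
Qed.

(** The term [t = s] accounts for 1, and the full sum is at most
    [expR x <= (1 - x)^-1 <= 1 + 2 x]. *)
Lemma sum_wrong_alignments n p (s : perm_tuple n p) (q x : R) : 0 <= q ->
  n%:R * q * (n * p)%:R = x -> x <= 2^-1 ->
  \sum_(t : perm_tuple n p | (0 < mismatches t s 1%g)%N) q ^+ mismatches t s 1%g
  <= 2 * x.
Proof.
move=> q0 xE x2.
have x0 : 0 <= x by rewrite -xE !mulr_ge0.
have mis0 : mismatches s s 1%g = 0%N.
  by apply: big1 => j _; apply: big1 => u _; rewrite perm1 eqxx.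
have h : 1 + \sum_(t : perm_tuple n p | (0 < mismatches t s 1%g)%N)
    q ^+ mismatches t s 1%g <= 1 + 2 * x.
  apply: (@le_trans _ _ (\sum_(t : perm_tuple n p) q ^+ mismatches t s 1%g)).
    rewrite [leRHS](bigD1 s)//= mis0 expr0 lerD2l.
    rewrite [leLHS]big_mkcond [leRHS]big_mkcond /=; apply: ler_sum => t _.
    case: ifP => [mt|_]; last by case: ifP => _; rewrite ?exprn_ge0.
    by case: eqP => //= ts; rewrite ts mis0 in mt.
  apply: (le_trans (sum_expr_mismatches s q0)).
  apply: (@le_trans _ _ (expR x)).
    rewrite -xE expRM_natr lerXn2r ?nnegrE ?expR_ge0//.
      by rewrite addr_ge0// mulr_ge0.
    exact: expR_ge1Dx.
  apply: (le_trans (expR_le_inv _)); first by lra.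
  by rewrite -[leLHS]mul1r ler_pdivrMr; nra.
by rewrite lerD2l in h.
Qed.

Lemma measure_bigsetU_le d (T : measurableType d) (mu : {measure set T -> \bar R})
    (I : Type) (r : seq I) (A : I -> set T) : (forall i, measurable (A i)) ->
  (mu (\big[setU/set0]_(i <- r) A i) <= \sum_(i <- r) mu (A i))%E.
Proof.
move=> mA; elim: r => [|i r IH]; first by rewrite !big_nil measure0.
rewrite !big_cons; apply: (le_trans (measureU2 _ (mA i) _)).
  exact: bigsetU_measurable.
exact: leeD.
Qed.

End UnionBound.

(** * Relabelling of alignments *)

Section Alignments.
Context {R : realType}.
Variables n p : nat.
Implicit Types (s t : perm_tuple n p).

Definition relabel t (psi : 'S_n) : perm_tuple n p := [ffun j => (t j * psi)%g].

Lemma alignment_score_relabel (g : observation R n p) t psi :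
  alignment_score g (relabel t psi) = alignment_score g t.
Proof.
apply: eq_bigr => j _; apply: eq_bigr => j' _.
apply: eq_bigr => e _; apply: eq_bigr => e' _.
by rewrite !ffunE !edge_actM (can_eq (edge_actK psi)).
Qed.

Lemma mismatches_relabel t s psi psi' :
  mismatches (relabel t psi) s psi' = mismatches t s (psi * psi')%g.
Proof.
by apply: eq_bigr => j _; apply: eq_bigr => u _; rewrite ffunE !permM.
Qed.

(** Picks representatives of relabelling classes for which [broken_pairs_ge] applies with
    [d = mismatches t s 1]. *)
Definition best_aligned t s : bool :=
  [forall psi : 'S_n, (mismatches t s 1%g <= mismatches t s psi)%N].

Lemma misalignedE t s psi :
  misaligned R t s psi = (n * p)%:R^-1 * (mismatches t s psi)%:R.
Proof.
rewrite /misaligned /mismatches exchange_big /= natr_sum.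
by congr (_ * _); apply: eq_bigr => j _; rewrite natr_sum.
Qed.

Lemma err_eq0 t s psi : mismatches t s psi = 0%N -> err R t s = 0.
Proof.
move=> m0; apply/le_anti/andP; split.
  apply: (@le_trans _ _ (misaligned R t s psi)).
    by rewrite /err (bigD1 psi)//= ge_min lexx.
  by rewrite misalignedE m0 mulr0.
rewrite /err; elim/big_ind: _ => [|x y x0 y0|psi' _].
- by rewrite misalignedE mulr_ge0// invr_ge0.
- by rewrite le_min x0.
- by rewrite misalignedE mulr_ge0// invr_ge0.
Qed.

Lemma best_relabeling t s : err R t s != 0 ->
  exists psi, best_aligned (relabel t psi) s /\
    (0 < mismatches (relabel t psi) s 1%g)%N.
Proof.
move=> et; case: (arg_minnP (mismatches t s) (erefl : predT (1%g : 'S_n))).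
move=> psi _ psi_min; exists psi; split.
  apply/forallP => psi'; rewrite !mismatches_relabel mulg1; exact: psi_min.
rewrite mismatches_relabel mulg1 lt0n; apply: contra et => /eqP m0.
by rewrite (err_eq0 m0).
Qed.

End Alignments.

(** * A fixed competitor against the true alignment *)

Section PairwiseError.
Context d (T : measurableType d) {R : realType} (P : probability T R).
Variables n p : nat.
Variables (pistar : T -> perm_tuple n p).
Variables (H0 : edge n -> {RV P >-> R}) (Z : 'I_p -> edge n -> {RV P >-> R}).
Hypothesis model : alignment_model pistar H0 Z.

Definition latent_var (i : edge n + 'I_p * edge n) : T -> R :=
  match i with inl e => H0 e | inr je => Z je.1 je.2 end.

Lemma measurable_latent_var i : measurable_fun setT (latent_var i).
Proof. by case: i => [e|[j e]]. Qed.

Lemma latent_var_normal i (B : set (measurableTypeR R)) : measurable B ->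
  P (latent_var i @^-1` B) = normal_prob 0 1 B.
Proof.
move=> mB; case: i => [e|[j e]] /=; first exact: (H0_gaussian model).
exact: (Z_gaussian model).
Qed.

Lemma latent_var_indep s : indep_normal P (pistar @^-1` [set s]) latent_var.
Proof.
move=> B mB.
pose A i := if i is Some i' then latent_var i' @^-1` B i' else pistar @^-1` [set s].
have AF i : model_events pistar H0 Z i (A i).
  case: i => [[e|[j e]]|] /=; rewrite /events_of_RV /events_of_discrete.
  - by exists (B (inl e)); [exact: mB|rewrite setTI].
  - by exists (B (inr (j, e))); [exact: mB|rewrite setTI].
  - by exists [set s]; rewrite ?setTI.
have prodE : (\prod_(i | i != None) P (A i) = \prod_i normal_prob 0 1 (B i))%E.
  rewrite (reindex_omap Some id) /=; last by case.
  by apply: eq_big => [i|i _]; rewrite ?eqxx//; exact: latent_var_normal.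
have indepA := model_independent model.
(* Independence is used for all indices but [None], giving the law of the variables, and then for
   all indices, adding the event on [pistar]. *)
split.
  have := indepA [set~ None]%SET A (fun i _ => AF i).
  under eq_bigl do rewrite !inE.
  rewrite prodE => <-; congr (P _); rewrite eqEsubset; split => w h.
    by case=> [i|]; rewrite /= !inE// => _; exact: h.
  by move=> i _; apply: (h (Some i)); rewrite /= !inE.
have := indepA [set: _]%SET A (fun i _ => AF i).
rewrite (bigD1 None) ?inE//=.
under eq_bigl do rewrite !inE /=.
rewrite prodE => <-; congr (P _); rewrite eqEsubset; split => w.
  by move=> [h h'] [i|] _ //; exact: h'.
move=> h; split=> [|i _]; first by apply: (h None); rewrite /= inE.
by apply: (h (Some i)); rewrite /= inE.
Qed.

Variable rho : R.
Hypotheses (rho_ge0 : 0 <= rho) (rho_le1 : rho <= 1) (rho_p : rho * p%:R <= 1).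

(** The observation is formed with [s] in place of [pistar], which changes nothing where [pistar] is
    [s]. Ties count, since the estimator is an arbitrary maximiser. *)
Definition beats s t : set T :=
  [set w | alignment_score (latent_obs rho s (latent_var^~ w)) s <=
           alignment_score (latent_obs rho s (latent_var^~ w)) t].

Lemma measurable_score s t : measurable_fun setT
  (fun w => alignment_score (latent_obs rho s (latent_var^~ w)) t).
Proof.
under eq_fun do rewrite alignment_score_quad.
apply: measurable_quad => a; apply: measurable_funD; apply: measurable_funM => //;
  exact: measurable_latent_var.
Qed.

Lemma measurable_beats s t : measurable (beats s t).
Proof.
rewrite -[X in measurable X]setTI.
exact: measurable_fun_le (measurable_score s s) (measurable_score s t).
Qed.

(* Markov's inequality for the exponential of the score difference. *)
Lemma prob_beats s t : (P (pistar @^-1` [set s] `&` beats s t) <=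
  P (pistar @^-1` [set s]) * (expR (- (rho ^+ 2 / 96 * (broken_pairs s t)%:R)))%:E)%E.
Proof.
have mE : measurable (pistar @^-1` [set s]) by exact: (pistar_measurable model).
have mB := measurable_beats s t.
have iX := latent_var_indep s.
apply: le_trans (integral_expR_score_diff rho_ge0 rho_le1 rho_p s t mE
  measurable_latent_var iX).
set f := fun w : T => (expR _)%:E.
have mf : measurable_fun setT f.
  apply/measurable_EFinP; apply: measurableT_comp => //.
  apply: measurable_funM => //; apply: measurable_funB; exact: measurable_score.
have f0 w : (0 <= f w)%E by rewrite lee_fin expR_ge0.
apply: (@le_trans _ _ (\int[P]_(w in pistar @^-1` [set s] `&` beats s t) f w)%E).
  rewrite -[leLHS]mul1e -integral_cst; last exact: measurableI.
  apply: ge0_le_integral => //; first exact: measurableI.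
    exact: measurable_funTS.
  move=> w [_ bw]; rewrite lee_fin -expR0 ler_expR mulr_ge0 ?divr_ge0// subr_ge0.
  exact: bw.
apply: ge0_subset_integral => //; first exact: measurableI.
exact: measurable_funTS.
Qed.

End PairwiseError.

(** * Union over competitors and average over the true alignment *)

Section UnionOverAlignments.
Context d (T : measurableType d) {R : realType} (P : probability T R).
Variables n p : nat.
Variables (pistar : T -> perm_tuple n p).
Variables (H0 : edge n -> {RV P >-> R}) (Z : 'I_p -> edge n -> {RV P >-> R}).
Hypothesis model : alignment_model pistar H0 Z.
Variable rho : R.
Hypotheses (rho_ge0 : 0 <= rho) (rho_le1 : rho <= 1) (rho_p : rho * p%:R <= 1).
Variable pihat : observation R n p -> perm_tuple n p.
Hypothesis pihat_mle : forall g, mle_set g (pihat g).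
Hypothesis pihat_measurable : forall pi,
  measurable [set w | pihat (observed pistar H0 Z rho w) = pi].

Let wrong : set T :=
  [set w | err R (pihat (observed pistar H0 Z rho w)) (pistar w) != 0].

Lemma measurable_wrong : measurable wrong.
Proof.
rewrite (_ : wrong = \bigcup_(st in [set st | err R st.2 st.1 != 0])
    (pistar @^-1` [set st.1] `&`
     [set w | pihat (observed pistar H0 Z rho w) = st.2])).
  apply: fin_bigcup_measurable => [|st _]; first exact: finite_finset.
  by apply: measurableI => //; exact: (pistar_measurable model).
rewrite eqEsubset; split => w /=.
  by move=> ew; exists (pistar w, pihat (observed pistar H0 Z rho w)).
by move=> [[s t] /= est [/= ws wt]]; rewrite /wrong /= wt ws.
Qed.

Lemma wrong_beats w : wrong w -> exists t,
  [/\ best_aligned t (pistar w), (0 < mismatches t (pistar w) 1%g)%N &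
      beats H0 Z rho (pistar w) t w].
Proof.
move=> /best_relabeling[psi [bt mt]].
exists (relabel (pihat (observed pistar H0 Z rho w)) psi).
split => //.
by rewrite /beats /= alignment_score_relabel; exact: (pihat_mle _ (pistar w)).
Qed.

(** For each true [s], of mass [N^-1], the sum over competitors is at most [2 x]; averaging over the
    [N] values of [s] keeps this bound. *)
Lemma prob_wrong (q : R) : 0 <= q ->
  (forall s t : perm_tuple n p, best_aligned t s ->
     expR (- (rho ^+ 2 / 96 * (broken_pairs s t)%:R)) <= q ^+ mismatches t s 1%g) ->
  forall x, n%:R * q * (n * p)%:R = x -> x <= 2^-1 -> (P wrong <= (2 * x)%:E)%E.
Proof.
move=> q0 qK x xE x2.
pose A (st : perm_tuple n p * perm_tuple n p) : set T :=
  if best_aligned st.2 st.1 && (0 < mismatches st.2 st.1 1%g)%N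
  then pistar @^-1` [set st.1] `&` beats H0 Z rho st.1 st.2 else set0.
have mA st : measurable (A st).
  rewrite /A; case: ifP => // _; apply: measurableI; last exact: measurable_beats.
  exact: (pistar_measurable model).
apply: (@le_trans _ _ (P (\big[setU/set0]_st A st))).
  apply: le_measure; rewrite ?inE; first exact: measurable_wrong.
    exact: bigsetU_measurable.
  move=> w /wrong_beats[t [bt mt bw]]; rewrite -bigcup_seq /=.
  exists (pistar w, t); first by rewrite /= mem_index_enum.
  by rewrite /A /= bt mt.
apply: (le_trans (measure_bigsetU_le _ _ mA)).
rewrite -(pair_bigA _ (fun s t => P (A (s, t)))) /=.
pose N : R := #|{: perm_tuple n p}|%:R.
have N0 : 0 < N.
  by rewrite ltr0n; apply/card_gt0P; exists [ffun=> 1%g].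
have iN0 : 0 <= N^-1 by rewrite invr_ge0 ltW.
apply: (@le_trans _ _ (\sum_(s : perm_tuple n p) (N^-1 * (2 * x))%:E)%E).
  apply: lee_sum => s _.
  apply: (@le_trans _ _ (\sum_(t : perm_tuple n p |
      (0 < mismatches t s 1%g)%N) (N^-1 * q ^+ mismatches t s 1%g)%:E)%E).
    rewrite [leRHS]big_mkcond /=; apply: lee_sum => t _; rewrite /A /=.
    case: ifP => [/andP[bt ->]|_]; last first.
      rewrite measure0; case: ifP => // _.
      by rewrite lee_fin mulr_ge0 ?exprn_ge0// invr_ge0 ltW.
    apply: (le_trans (prob_beats model rho_ge0 rho_le1 rho_p s t)).
    rewrite (pistar_uniform model) -EFinM lee_fin ler_wpM2l ?invr_ge0// qK//.
  rewrite sumEFin lee_fin -mulr_sumr ler_wpM2l//.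
  exact: (sum_wrong_alignments s q0 xE x2).
by rewrite sumEFin lee_fin sumr_const -[leLHS]mulr_natl mulrA divff ?mul1r ?gt_eqF.
Qed.

End UnionOverAlignments.

(** * Numerical estimates *)

Section Numerics.
Context {R : realType}.
Variables (n p : nat) (rho : R).
Hypotheses (n4 : (4 <= n)%N) (p2 : (2 <= p)%N).
Hypotheses (rho_ge0 : 0 <= rho) (rho_p : rho * p%:R <= 1).
Hypothesis rho_ge : 64 * Num.sqrt (ln n%:R / (n * p)%:R) <= rho.

Let n4R : 4 <= n%:R :> R. Proof. by rewrite (ler_nat R 4). Qed.
Let p2R : 2 <= p%:R :> R. Proof. by rewrite (ler_nat R 2). Qed.
Let y : R := rho ^+ 2 * (n * p)%:R.

Lemma ln_ge_half : 2^-1 <= ln n%:R :> R.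
Proof.
rewrite -ler_expR lnK ?posrE; last by have := n4R; lra.
apply: (le_trans (expR_le_inv _)); first by lra.
by have := n4R; rewrite [X in X^-1](_ : _ = 2^-1) ?invrK; lra.
Qed.

Lemma signal_ge : 4096 * ln n%:R <= y.
Proof.
have np0 : 0 < (n * p)%:R :> R.
  by rewrite ltr0n muln_gt0 !(leq_trans _ n4, leq_trans _ p2).
have l0 : 0 <= ln n%:R :> R by have := ln_ge_half; lra.
rewrite /y -ler_pdivrMr//.
have h0 : 0 <= ln n%:R / (n * p)%:R :> R by rewrite divr_ge0.
have r0 := sqrtr_ge0 (ln n%:R / (n * p)%:R).
have r2 := sqr_sqrtr h0; rewrite -mulrA -r2.
move: rho_ge; rewrite -ler_sqr ?nnegrE ?mulr_ge0//; apply: le_trans.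
by rewrite le_eqVlt; apply/orP; left; apply/eqP; ring.
Qed.

Lemma p_le_n : p%:R <= n%:R :> R.
Proof.
have yl := signal_ge; have l2 := ln_ge_half.
have rp0 : 0 <= rho * p%:R by rewrite mulr_ge0.
have rp2 : (rho * p%:R) ^+ 2 <= 1 by rewrite expr_le1.
have h : p%:R * (4096 * ln n%:R) <= n%:R :> R.
  apply: (@le_trans _ _ (p%:R * y)); first by rewrite ler_wpM2l.
  rewrite /y natrM (_ : _ * _ = n%:R * (rho * p%:R) ^+ 2); last by ring.
  by rewrite ler_piMr.
by apply: le_trans h; rewrite ler_peMr//; lra.
Qed.

(** Half of the exponent absorbs the prefactor: [2 n^2 p <= n^4], and [n^4 expR (- y / 768) <= 1]
    because [y >= 3072 ln n]. *)
Lemma union_bound_numeric :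
  2 * (n%:R * expR (- (y / 384)) * (n * p)%:R) <= expR (- (y / 768)).
Proof.
have pn := p_le_n; have l2 := ln_ge_half.
move: (y) signal_ge => z zl.
have n0 : 0 < n%:R :> R by have := n4R; lra.
have expn : expR (ln n%:R) = n%:R :> R by rewrite lnK.
rewrite (_ : - (z / 384) = - (z / 768) + - (z / 768)); last by field.
rewrite expRD; set e := expR (- (z / 768)).
have e0 : 0 <= e by exact: expR_ge0.
have n4e : n%:R ^+ 4 * e <= 1.
  rewrite -expn -expRM_natl -expRD -[leRHS]expR0 ler_expR; lra.
apply: (@le_trans _ _ (e * (n%:R ^+ 4 * e))); last by rewrite ler_piMr.
rewrite natrM.
rewrite (_ : 2 * _ = (2 * (n%:R ^+ 2 * p%:R)) * (e * e)); last by ring.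
rewrite (_ : e * (_ * e) = n%:R ^+ 4 * (e * e)); last by ring.
rewrite ler_wpM2r ?mulr_ge0//.
rewrite (_ : n%:R ^+ 4 = n%:R * (n%:R ^+ 2 * n%:R)); last by ring.
apply: ler_pM; rewrite ?mulr_ge0 ?exprn_ge0//; first by have := n4R; lra.
by rewrite ler_wpM2l ?exprn_ge0.
Qed.

Lemma union_bound_le_half : n%:R * expR (- (y / 384)) * (n * p)%:R <= 2^-1.
Proof.
have y0 : 0 <= y := mulr_ge0 (sqr_ge0 rho) (ler0n R (n * p)).
have e1 : expR (- (y / 768)) <= 1.
  by rewrite -[leRHS]expR0 ler_expR oppr_le0; exact: divr_ge0 y0 (ler0n R 768).
have := le_trans union_bound_numeric e1.
by move: (n%:R * _ * _) => x; lra.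
Qed.

Lemma broken_pairs_bound (s t : perm_tuple n p) : best_aligned t s ->
  expR (- (rho ^+ 2 / 96 * (broken_pairs s t)%:R)) <=
  expR (- (y / 384)) ^+ mismatches t s 1%g.
Proof.
move=> /forallP bt; have := broken_pairs_ge bt; set D := mismatches _ _ _.
set K := broken_pairs _ _ => KD.
rewrite -expRM_natl ler_expR mulrN lerN2.
have KDR : p%:R * D%:R * n%:R <= 4 * K%:R :> R.
  rewrite -!natrM ler_nat.
  (* For [n >= 4], [n <= 2 (n - 2)]; this loses the factor 4 that turns 96 into 384. *)
  apply: (@leq_trans (2 * (p * D * (n - 2)))).
    rewrite mulnCA leq_mul2l; apply/orP; right.
    by move: n4; clear; lia.
  apply: (@leq_trans (2 * (2 * K))); first by rewrite leq_mul2l.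
  by rewrite mulnA.
rewrite /y natrM.
rewrite (_ : _ * (_ / 384) = rho ^+ 2 / 384 * (p%:R * D%:R * n%:R)); last by field.
rewrite (_ : _ / 96 * _ = rho ^+ 2 / 384 * (4 * K%:R)); last by field.
exact: (ler_wpM2l (divr_ge0 (sqr_ge0 rho) (ler0n R 384)) KDR).
Qed.

End Numerics.

Theorem theorem3p1 (R : realType) :
  exists (C c1 c2 : R) (n0 : nat),
    [/\ 0 < C, 0 < c1, 0 < c2 & (1 <= n0)%N] /\
    forall (n p : nat) (rho : R),
      (2 <= n)%N -> (2 <= p)%N -> 0 <= rho <= 1 ->
      c1 * Num.sqrt (ln n%:R / (n * p)%:R) <= rho ->
      p%:R <= C * rho^-1 ->
      (n0 <= n)%N ->
    forall (d : measure_display) (T : measurableType d) (P : probability T R)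
      (pistar : T -> perm_tuple n p)
      (H0 : edge n -> {RV P >-> R}) (Z : 'I_p -> edge n -> {RV P >-> R}),
      alignment_model pistar H0 Z ->
    forall pihat : observation R n p -> perm_tuple n p,
      (forall g, mle_set g (pihat g)) ->
      (forall pi,
         measurable [set w | pihat (observed pistar H0 Z rho w) = pi]) ->
      (P [set w | err R (pihat (observed pistar H0 Z rho w)) (pistar w) != 0%R]
       <= (expR (- (c2 * (n * p)%:R * rho ^+ 2)))%:E)%E.
Proof.
(* [C = 1] gives [rho p <= 1], [64^2 = 4096] is the signal constant, and [768 = 2 * 384] leaves half
   of the exponent. *)
exists 1, 64, 768^-1, 4%N; split; first by rewrite ?invr_gt0 !ltr0n.
move=> n p rho _ p2 /andP[rho0 rho1] rho_ge p_le n4.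
move=> d T P pistar H0 Z model pihat mle mpihat.
have rho_p : rho * p%:R <= 1.
  (* The inverse of 0 is 0, so the bound on [p] is cleared of its denominator only for positive
     [rho]. *)
  have [->|rhoN0] := eqVneq rho 0; first by rewrite mul0r ler01.
  have rho_gt0 : 0 < rho by rewrite lt_def rhoN0.
  by rewrite mulrC -ler_pdivlMr.
have x2 := union_bound_le_half n4 p2 rho0 rho_p rho_ge.
have qK (s t : perm_tuple n p) := @broken_pairs_bound R n p rho n4 s t.
have := prob_wrong model rho0 rho1 rho_p mle mpihat (expR_ge0 _) qK erefl x2.
move=> /le_trans; apply; rewrite lee_fin.
apply: (le_trans (union_bound_numeric n4 p2 rho0 rho_p rho_ge)).
have -> : 768^-1 * (n * p)%:R * rho ^+ 2 = rho ^+ 2 * (n * p)%:R / 768.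
  by rewrite mulrAC -mulrA mulrC.
exact: lexx.
Qed.
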